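(* Let $\mathcal B$ be a unital complex Banach algebra with unit $I$, and let $A_{-1},A_0,A_1,G,V\in\mathcal B$ be such that $A_0$ is invertible in $\mathcal B$ and $$A_1G^2+A_0G+A_{-1}=0,\qquad A_{-1}V^2+A_0V+A_1=0,$$ with $\rho(G)\le1$, $\rho(V)\le1$, $\rho(G)\rho(V)<1$. Let $\widetilde G\in\mathcal B$ be such that $A_0+A_1\widetilde G$ and $I-\widetilde GV$ are invertible in $\mathcal B$, and set $H=G-\widetilde G$, $Y=V(I-\widetilde GV)^{-1}$, $Z=(I-\widetilde GV)V(I-\widetilde GV)^{-1}$. Let $$P_0=-(A_0+A_1\widetilde G)^{-1}(A_1\widetilde G^2+A_0\widetilde G+A_{-1}),\quad E_0=\widetilde G+P_0,\quad F_0=Q_0=-(A_0+A_1\widetilde G)^{-1}A_1,$$ and assume that the SDA iteration in $\mathcal B$ with these initial values can be carried out with no breakdown. Then $\lim_k\|P_k-H\|=0$, and for all $k\ge0$ $$E_k=(I-Q_kH)G^{2^k},\quad H-P_k=F_kHG^{2^k},\quad F_k=(I-P_kY)Z^{2^k},\quad Y-Q_k=E_kYZ^{2^k}.$$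
   Context: In the paper $\mathcal B$ is an algebra of (possibly infinite) matrices endowed with an operator norm $\|\cdot\|$ that makes it a Banach space; in particular the norm is submultiplicative. For $A\in\mathcal B$ the spectral radius is $\rho(A)=\sup\{|\lambda|:\lambda I-A\text{ is not invertible in }\mathcal B\}$. The SDA (Structure-preserving Doubling Algorithm) iteration with initial elements $E_0,F_0,P_0,Q_0\in\mathcal B$ is, for $k=0,1,\ldots$, $$E_{k+1}=E_k(I-Q_kP_k)^{-1}E_k,\qquad P_{k+1}=P_k+F_k(I-P_kQ_k)^{-1}P_kE_k,$$ $$F_{k+1}=F_k(I-P_kQ_k)^{-1}F_k,\qquad Q_{k+1}=Q_k+E_k(I-Q_kP_k)^{-1}Q_kF_k.$$ It can be carried out with no breakdown if $I-P_kQ_k$ and $I-Q_kP_k$ are invertible in $\mathcal B$ for all $k\ge0$. *)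

(* Defs.v *)
From HB Require Import structures.
From mathcomp Require Import all_boot all_order all_algebra.
From mathcomp Require Import all_classical all_reals all_analysis.
From mathcomp Require Import complex.
Import numFieldNormedType.Exports.
Import Order.TTheory GRing.Theory Num.Theory.

Set Implicit Arguments.
Unset Strict Implicit.
Unset Printing Implicit Defensive.

Local Open Scope ring_scope.
Local Open Scope classical_set_scope.

(* The norm is real-valued and [|l|] is the library's modulus on R[i], which
   takes its values in the nonnegative reals of R[i], hence the [Re].
   The norm is a field of the record because no HB structure can join
   [completeNormedModType R[i]] and [unitAlgType R[i]]: in the hierarchy every
   ring carrying the library's norm is a [numDomainType].
   [bnorm 1 = 1] is not imposed.  By [unitrP], [x \is a GRing.unit] says that x
   has a two-sided inverse in the algebra, and [x^-1] is then that inverse. *)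
Record banachAlg (R : realType) := BanachAlg {
  banach_alg :> unitAlgType R[i];
  bnorm : banach_alg -> R;
  bnorm_ge0 : forall x, 0 <= bnorm x;
  bnorm0_eq0 : forall x, bnorm x = 0 -> x = 0;
  ler_bnormD : forall x y, bnorm (x + y) <= bnorm x + bnorm y;
  bnormZ : forall (l : R[i]) x, bnorm (l *: x) = complex.Re `|l| * bnorm x;
  ler_bnormM : forall x y, bnorm (x * y) <= bnorm x * bnorm y;
  bnorm_complete : forall u : nat -> banach_alg,
    (forall e : R, 0 < e -> exists N : nat, forall m n : nat,
       (N <= m)%N -> (N <= n)%N -> bnorm (u m - u n) < e) ->
    exists l : banach_alg, (fun n => bnorm (u n - l)) @ \oo --> (0 : R)
}.

Definition spectrum (R : realType) (B : banachAlg R) (a : B) : set R[i] :=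
  [set l | l%:A - a \isn't a GRing.unit].

(* In a Banach algebra the spectrum is nonempty and bounded, so that [sup] is
   a genuine supremum here. *)
Definition spectral_radius (R : realType) (B : banachAlg R) (a : B) : R :=
  sup [set complex.Re `|l| | l in spectrum a].

Record sda_state (B : unitRingType) :=
  SdaState { sdaE : B; sdaF : B; sdaP : B; sdaQ : B }.

Definition sda_step (B : unitRingType) (s : sda_state B) : sda_state B :=
  let: SdaState E F P Q := s in
  SdaState
    (E * (1 - Q * P)^-1 * E)
    (F * (1 - P * Q)^-1 * F)
    (P + F * (1 - P * Q)^-1 * P * E)
    (Q + E * (1 - Q * P)^-1 * Q * F).

Definition sda (B : unitRingType) (E0 F0 P0 Q0 : B) (k : nat) : sda_state B :=
  iter k (@sda_step B) (SdaState E0 F0 P0 Q0).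

Definition sda_no_breakdown (B : unitRingType) (E0 F0 P0 Q0 : B) : Prop :=
  forall k : nat,
    let P := sdaP (sda E0 F0 P0 Q0 k) in
    let Q := sdaQ (sda E0 F0 P0 Q0 k) in
    (1 - P * Q \is a GRing.unit) /\ (1 - Q * P \is a GRing.unit).

(* Main.v *)
Require Import Defs.
From HB Require Import structures.
From mathcomp Require Import all_boot all_order all_algebra.
From mathcomp Require Import all_classical all_reals all_analysis.
From mathcomp Require Import complex lra.
Import numFieldNormedType.Exports.
Import Order.TTheory GRing.Theory Num.Theory.

Set Implicit Arguments.
Unset Strict Implicit.
Unset Printing Implicit Defensive.

Local Open Scope ring_scope.
Local Open Scope classical_set_scope.

(** The four identities are purely algebraic.  They hold for [k = 0] by the two
    quadratic equations ([sda0_invariantEP], [sda0_invariantFQ]), and one step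
    of the iteration replaces [G ^+ (2 ^ k)] and [Z ^+ (2 ^ k)] by their squares
    ([sda_step_invariant]).

    For the limit put [D = P k - H] and [N = 2 ^ k].  Eliminating [F k] between
    the second and the third identity gives
    [D = (H * Y - 1 + D * Y) * (Z ^+ N * H * G ^+ N)], so that [D] tends to 0 as
    soon as the last factor does ([cvg0_of_affine_bound]).  That factor tends to
    0 because [Z] is similar to [V] and, after a rescaling, the powers of [V] and
    of [G] both tend to 0 ([bnorm_conj_sandwich_cvg0]).

    What remains is the spectral radius formula in the form: if
    [s * spectral_radius a < 1], then [(s a)^(2^k)] tends to 0
    ([bnorm_iter_sqr_cvg0]).  Only exponents [2 ^ k] occur, which allows a proof
    without contour integrals.  On the disc of radius [s] the functions
    [g_k(l) = (1 - (l a)^(2^k))^-1] satisfy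
    [g_(k+1)(l) = (g_k(l) + g_k(z l)) / 2] with [z^(2^k) = -1], hence they all
    share the Lipschitz constant of the resolvent [g_0]
    ([iter_resolvent_lipschitz]), which is finite by compactness
    ([resolvent_bounded]).  They tend to 1 near [l = 0], and equicontinuity
    carries this to the boundary of the disc, where it says that [(s a)^(2^k)]
    is small for some [k]. *)

Local Notation normc := ComplexField.Normc.normc.

(** * The algebra of the doubling iteration *)

(** One doubling step squares [g].  Everything rests on
    [(1 - Q * P) * g - Q * (H - P) * g = (1 - Q * H) * g] and its mirror image,
    in which the invariants are substituted for [H - P] and [E].
    The recursion and the invariants are stable under
    (E, F, P, Q, H, g) -> (F, E, Q, P, Y, z), so the lemma applies twice:
    once to (H, G) and once to (Y, Z). *)
Lemma sda_step_invariant (B : unitRingType) (E F P Q H g : B) :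
    1 - P * Q \is a GRing.unit -> 1 - Q * P \is a GRing.unit ->
    E = (1 - Q * H) * g -> H - P = F * H * g ->
  E * (1 - Q * P)^-1 * E
    = (1 - (Q + E * (1 - Q * P)^-1 * Q * F) * H) * (g * g) /\
  H - (P + F * (1 - P * Q)^-1 * P * E)
    = F * (1 - P * Q)^-1 * F * H * (g * g).
Proof.
move=> uPQ uQP hE hP; split.
  have -> : (1 - (Q + E * (1 - Q * P)^-1 * Q * F) * H) * (g * g)
      = E * g - E * (1 - Q * P)^-1 * (Q * (H - P) * g).
    rewrite [_ * H]mulrDl opprD addrA mulrBl hP; congr (_ - _).
      by rewrite mulrA -hE.
    by rewrite !mulrA.
  rewrite -{3}[E](mulrVK uQP) -!mulrA -!mulrBr {2}hE; congr (_ * (_ * _)).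
  rewrite !(mulrA, mulrBr, mulrBl, mul1r).
  by rewrite opprB addrA subrK.
rewrite opprD addrA {1}hP -{1}[F](mulrVK uPQ) -!mulrA -!mulrBr hE.
have -> : F * (H * (g * g)) = (H - P) * g by rewrite hP !mulrA.
congr (_ * (_ * _)).
by rewrite !(mulrA, mulrBr, mulrBl, mul1r, mulr1) opprB addrA subrK.
Qed.

(** With [W = A0 + A1 * T] the initial value is [P0 = - T - W^-1 * Am1], hence
    [E0 = - W^-1 * Am1]; the equation for [G] gives
    [Am1 = - (A1 * (G - T) + W) * G]. *)
Lemma sda0_invariantEP (B : unitRingType) (Am1 A0 A1 G T : B) :
    A1 * G ^+ 2 + A0 * G + Am1 = 0 -> A0 + A1 * T \is a GRing.unit ->
  let P0 := - ((A0 + A1 * T)^-1 * (A1 * T ^+ 2 + A0 * T + Am1)) in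
  let Q0 := - ((A0 + A1 * T)^-1 * A1) in
  T + P0 = (1 - Q0 * (G - T)) * G /\ G - T - P0 = Q0 * (G - T) * G.
Proof.
move=> hG uW P0 Q0; set W := A0 + A1 * T in uW P0 Q0 *.
have hP0 : P0 = - T - W^-1 * Am1.
  have e : A1 * T ^+ 2 + A0 * T = W * T by rewrite mulrDl addrC expr2 mulrA.
  by rewrite /P0 e mulrDr (mulKr uW) opprD.
have WQ0 : W * Q0 = - A1 by rewrite mulrN (mulVKr uW).
have hG' : W^-1 * Am1 = Q0 * (G - T) * G - G.
  apply: (mulrI uW); rewrite (mulVKr uW) [RHS]mulrBr !mulrA WQ0.
  rewrite !mulNr -opprD -mulrDl mulrBr [W]addrC addrA subrK mulrDl -mulrA.
  by apply/eqP; rewrite -addr_eq0 addrC; apply/eqP.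
split; first by rewrite hP0 addrA subrr sub0r hG' opprB mulrBl mul1r.
by rewrite hP0 opprD opprK opprK addrA subrK hG' addrC subrK.
Qed.

(** Since [Y * Z = V^2 * S^-1], the equation for [V] enters as
    [Am1 * V^2 = - (A1 * S + W * V)]. *)
Lemma sda0_invariantFQ (B : unitRingType) (Am1 A0 A1 V T : B) :
    Am1 * V ^+ 2 + A0 * V + A1 = 0 -> A0 + A1 * T \is a GRing.unit ->
    1 - T * V \is a GRing.unit ->
  let S := 1 - T * V in
  let Y := V * S^-1 in
  let Z := S * V * S^-1 in
  let P0 := - ((A0 + A1 * T)^-1 * (A1 * T ^+ 2 + A0 * T + Am1)) in
  let Q0 := - ((A0 + A1 * T)^-1 * A1) in
  Q0 = (1 - P0 * Y) * Z /\ Y - Q0 = (T + P0) * Y * Z.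
Proof.
move=> hV uW uS S Y Z P0 Q0; rewrite -/S in uS.
set W := A0 + A1 * T in uW P0 Q0 *.
have hP0 : P0 = - T - W^-1 * Am1.
  have e : A1 * T ^+ 2 + A0 * T = W * T by rewrite mulrDl addrC expr2 mulrA.
  by rewrite /P0 e mulrDr (mulKr uW) opprD.
have YZ : Y * Z = V * V * S^-1 by rewrite /Y /Z !mulrA (mulrVK uS).
have WQ0 : W * Q0 = - A1 by rewrite mulrN (mulVKr uW).
have hVQ : W^-1 * Am1 * (V * V) = Q0 * S - V.
  apply: (mulrI uW); rewrite [RHS]mulrBr !mulrA (divrr uW) WQ0 mul1r.
  rewrite mulNr -opprD /S mulrBr mulr1 [W]addrC mulrDl -!mulrA addrA subrK.
  by apply/eqP; rewrite -addr_eq0 [A1 + _]addrC addrA; apply/eqP.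
have hEYZ : (T + P0) * Y * Z = Y - Q0.
  rewrite hP0 addrA subrr sub0r -mulrA YZ mulNr mulrA hVQ mulrBl (mulrK uS).
  by rewrite opprB.
split=> //.
have -> : (1 - P0 * Y) * Z = Z + T * (Y * Z) - (T + P0) * Y * Z.
  by rewrite mulrDl mul1r mulNr !mulrDl opprD addrA !mulrA addrK.
have -> : Z + T * (Y * Z) = Y.
  by rewrite YZ /Z {1}/S mulrBl mul1r mulrBl !mulrA subrK.
by rewrite hEYZ opprB addrC subrK.
Qed.

Lemma sda_closed_form (B : unitRingType) (E0 F0 P0 Q0 H G Y Z : B) :
    sda_no_breakdown E0 F0 P0 Q0 ->
    E0 = (1 - Q0 * H) * G -> H - P0 = F0 * H * G ->
    F0 = (1 - P0 * Y) * Z -> Y - Q0 = E0 * Y * Z ->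
  forall k, let: SdaState E F P Q := sda E0 F0 P0 Q0 k in
    [/\ E = (1 - Q * H) * G ^+ (2 ^ k),
        H - P = F * H * G ^+ (2 ^ k),
        F = (1 - P * Y) * Z ^+ (2 ^ k) &
        Y - Q = E * Y * Z ^+ (2 ^ k)].
Proof.
move=> nb hE hP hF hQ; elim=> [|k]; first by rewrite /sda /= !expr1.
have [] := nb k; rewrite /sda iterS; case: (iter k _ _) => E F P Q /=.
move=> uPQ uQP [iE iP iF iQ]; rewrite expnS mul2n -addnn !exprD.
have [eE eP] := sda_step_invariant uPQ uQP iE iP.
by have [eF eQ] := sda_step_invariant uQP uPQ iF iQ.
Qed.

(** * The modulus of complex numbers *)

Lemma normc_ge0 (R : realType) (l : R[i]) : 0 <= normc l.
Proof. by case: l => x y; exact: sqrtr_ge0. Qed.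

Lemma normcD_le (R : realType) (l m : R[i]) :
  normc (l + m) <= normc l + normc m.
Proof. exact: (@le_normcD R l m). Qed.

Lemma normc_real (R : realType) (r : R) : normc (r%:C)%C = `|r|.
Proof. by rewrite /= expr0n /= addr0 sqrtr_sqr. Qed.

Lemma normc_le_coord (R : realType) (x y : R) :
  normc (x +i* y)%C <= `|x| + `|y|.
Proof.
have h : 0 <= `|x| + `|y| by rewrite addr_ge0.
rewrite /= -[leRHS](ger0_norm h) -sqrtr_sqr ler_wsqrtr//.
rewrite sqrrD !real_normK ?num_real// addrAC lerDl.
by rewrite mulrn_wge0// mulr_ge0.
Qed.

Lemma normc_sub_coord (R : realType) (l m : R[i]) (d : R) :
    `|complex.Re l - complex.Re m| <= d ->
    `|complex.Im l - complex.Im m| <= d ->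
  normc (l - m) <= d + d.
Proof.
case: l => x y; case: m => z t /= h1 h2.
by apply: le_trans (normc_le_coord (x - z) (y - t)) _; rewrite lerD.
Qed.

Lemma coord_le_normc (R : realType) (l : R[i]) :
  `|complex.Re l| <= normc l /\ `|complex.Im l| <= normc l.
Proof.
case: l => x y /=; rewrite -[`|x|]sqrtr_sqr -[`|y|]sqrtr_sqr.
by rewrite !ler_wsqrtr// ?lerDl ?lerDr sqr_ge0.
Qed.

Lemma root_minus1 (R : realType) n : (0 < n)%N ->
  exists2 z : R[i], z ^+ n = -1 & normc z = 1.
Proof.
move=> n0; exists (n.-root (-1)); first by rewrite rootCK.
have : `|n.-root (-1 : R[i])| ^+ n == 1 by rewrite -normrX rootCK// normrN1.
by rewrite pexpr_eq1// => /eqP[].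
Qed.

Local Arguments ComplexField.Normc.normc : simpl never.

(** * Norm, Neumann series and spectrum *)

Lemma bnorm_scale (R : realType) (B : banachAlg R) (l : R[i]) (x : B) :
  bnorm (l *: x) = normc l * bnorm x.
Proof. exact: bnormZ. Qed.

Lemma bnorm0 (R : realType) (B : banachAlg R) : bnorm (0 : B) = 0.
Proof. by rewrite -(scale0r 0) bnorm_scale ComplexField.Normc.normc0 mul0r. Qed.

Lemma bnormN (R : realType) (B : banachAlg R) (x : B) : bnorm (- x) = bnorm x.
Proof. by rewrite -scaleN1r bnormZ normrN1 mul1r. Qed.

Lemma bnorm_distC (R : realType) (B : banachAlg R) (x y : B) :
  bnorm (x - y) = bnorm (y - x).
Proof. by rewrite -bnormN opprB. Qed.

Lemma ler_bnormB (R : realType) (B : banachAlg R) (x y : B) :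
  bnorm (x - y) <= bnorm x + bnorm y.
Proof. by rewrite -(bnormN y); exact: ler_bnormD. Qed.

(** Identities between limits in the algebra are checked on real upper bounds. *)
Lemma bnorm_cvg0_eq0 (R : realType) (B : banachAlg R) (x : B) (v : R^nat) :
  (forall n, bnorm x <= v n) -> v @ \oo --> 0 -> x = 0.
Proof.
move=> xv v0; apply: bnorm0_eq0; apply/eqP; rewrite eq_le bnorm_ge0 andbT.
by apply: cvgr_to_ge v0 _; apply: nearW.
Qed.

(** The factor [bnorm 1] is there because the norm of the unit is arbitrary. *)
Lemma bnormX_half (R : realType) (B : banachAlg R) (x : B) (n : nat) :
  bnorm x <= 2^-1 ->
  bnorm (x ^+ n) <= bnorm (1 : B) * 2^-1 ^+ n.
Proof.
move=> hx; elim: n => [|n IH]; first by rewrite !expr0 mulr1.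
rewrite !exprSr mulrA; apply: le_trans (ler_bnormM _ _) _.
by apply: ler_pM; rewrite ?bnorm_ge0.
Qed.

Lemma cvg_half_expr (R : realType) (K : R) :
  (fun n => K * 2^-1 ^+ n) @ \oo --> 0.
Proof.
by apply: cvg_geometric; rewrite ger0_norm ?invr_ge0// invf_lt1// ltr1n.
Qed.

(** Neumann series.  A ball of radius 1/2 is all that the boundedness of the
    spectrum requires. *)
Lemma unitr_1B (R : realType) (B : banachAlg R) (x : B) :
  bnorm x <= 2^-1 -> 1 - x \is a GRing.unit.
Proof.
move=> hx; set c := bnorm (1 : B).
have c0 : 0 <= c by exact: bnorm_ge0.
have hX n := bnormX_half n hx.
pose u n := \sum_(i < n) x ^+ i.
have ub n : bnorm (u n) <= c + c.
  elim: n => [|n IH]; first by rewrite /u big_ord0 bnorm0 addr_ge0.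
  have -> : u n.+1 = 1 + x * u n.
    by rewrite /u big_ord_recl expr0 mulr_sumr; under eq_bigr do rewrite exprS.
  apply: le_trans (ler_bnormD _ _) _; rewrite lerD2l.
  apply: le_trans (ler_bnormM _ _) _.
  have : bnorm x * bnorm (u n) <= 2^-1 * (c + c).
    by apply: ler_pM; rewrite ?bnorm_ge0.
  by move=> /le_trans; apply; rewrite mulrDr; lra.
have uD n p : u (n + p)%N - u n = x ^+ n * u p.
  rewrite /u big_split_ord /= [X in X - _]addrC addrK mulr_sumr.
  by under eq_bigr do rewrite exprD.
have hu n : (1 - x) * u n = 1 - x ^+ n.
  by rewrite -opprB mulNr -subrX1 opprB.
have hu' n : u n * (1 - x) = 1 - x ^+ n.
  rewrite -hu /u mulr_sumr mulr_suml; apply: eq_bigr => i _.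
  by rewrite mulrBl mulrBr mul1r mulr1 -exprS -exprSr.
pose K := c * (c + c).
have cauchy n p : bnorm (u (n + p)%N - u n) <= K * 2^-1 ^+ n.
  rewrite uD; apply: le_trans (ler_bnormM _ _) _.
  rewrite /K mulrAC; apply: ler_pM; rewrite ?bnorm_ge0//.
have [|l hl] := @bnorm_complete R B u.
  move=> e e0.
  have /cvgrPdist_lt/(_ e e0)[N _ hN] := cvg_half_expr K.
  have hN' n p : (N <= n)%N -> bnorm (u (n + p)%N - u n) < e.
    move=> Nn; apply: le_lt_trans (cauchy _ _) _.
    apply: le_lt_trans (hN n Nn); rewrite sub0r normrN; exact: ler_norm.
  exists N => m n Nm Nn; have [mn|/ltnW nm] := leqP m n.
    by rewrite bnorm_distC -(subnKC mn); exact: hN'.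
  by rewrite -(subnKC nm); exact: hN'.
have lim0 : (fun n => bnorm (1 - x) * bnorm (u n - l) + c * 2^-1 ^+ n) @ \oo --> 0.
  rewrite -[X in _ --> X](addr0 0); apply: cvgD; last exact: cvg_half_expr.
  rewrite -[X in _ --> X](mulr0 (bnorm (1 - x))); apply: cvgM => //; exact: cvg_cst.
apply/unitrP; exists l; split; apply/eqP; rewrite -subr_eq0; apply/eqP.
- apply: bnorm_cvg0_eq0 lim0 => n.
  have -> : l * (1 - x) - 1 = - ((u n - l) * (1 - x)) - x ^+ n.
    by rewrite mulrBl hu' opprB -addrA opprB [_ - 1 - _]addrAC subrr sub0r.
  apply: le_trans (ler_bnormB _ _) _; rewrite bnormN lerD//.
  by rewrite mulrC ler_bnormM.
- apply: bnorm_cvg0_eq0 lim0 => n.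
  have -> : (1 - x) * l - 1 = - ((1 - x) * (u n - l)) - x ^+ n.
    by rewrite mulrBr hu opprB -addrA opprB [_ - 1 - _]addrAC subrr sub0r.
  apply: le_trans (ler_bnormB _ _) _; rewrite bnormN lerD//.
  by rewrite ler_bnormM.
Qed.

(** Without an upper bound the supremum in [spectral_radius] would take its
    default value and say nothing about the spectrum. *)
Lemma spectrum_bounded (R : realType) (B : banachAlg R) (a : B) (l : R[i]) :
  spectrum a l -> normc l <= 2 * bnorm a.
Proof.
rewrite /spectrum /= => hl; rewrite leNgt; apply/negP => al.
move/negP: hl; apply.
have l0 : 0 < normc l by apply: le_lt_trans al; rewrite mulr_ge0// bnorm_ge0.
have ln0 : l != 0
  by apply: contraTneq l0 => ->; rewrite ComplexField.Normc.normc0 ltxx.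
have -> : l%:A - a = l *: (1 - l^-1 *: a).
  by rewrite scalerBr scalerA divff// scale1r.
rewrite scaler_unit ?unitfE//; apply: unitr_1B.
rewrite bnorm_scale ComplexField.Normc.normcV mulrC ler_pdivrMr//.
by rewrite ler_pdivlMl// ltW.
Qed.

Lemma spectral_radius_ge0 (R : realType) (B : banachAlg R) (a : B) :
  0 <= spectral_radius a.
Proof.
rewrite /spectral_radius; set S := [set _ | _ in _].
have [->|/set0P[r hr]] := eqVneq S set0; first by rewrite sup0.
case: (hr) => l hl e; apply: (@le_trans _ _ r); first by rewrite -e; exact: normc_ge0.
apply: ub_le_sup => //; exists (2 * bnorm a) => _ [m hm <-].
exact: spectrum_bounded.
Qed.

(** The resolvent written in the variable [l = 1 / lambda]: the complement of
    the spectral disc, infinity included, becomes a bounded disc around 0. *)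
Lemma unitr_1BZ (R : realType) (B : banachAlg R) (a : B) (s : R) (l : R[i]) :
  s * spectral_radius a < 1 -> normc l <= s -> 1 - l *: a \is a GRing.unit.
Proof.
move=> hs ls; have [->|l0] := eqVneq l 0; first by rewrite scale0r subr0 unitr1.
have nl0 : 0 < normc l.
  by rewrite lt0r normc_ge0 andbT;
  apply: contra_neq l0 => /ComplexField.Normc.eq0_normc.
rewrite -[X in X \is a _](scale1r) -(divff l0) -scalerA scaler_unit ?unitfE//.
rewrite scalerBr scalerA mulVf// scale1r; apply: contraTT hs => hl.
rewrite -leNgt -(divff (lt0r_neq0 nl0)); apply: ler_pM => //.
- exact: normc_ge0.
- by rewrite invr_ge0 normc_ge0.
rewrite -ComplexField.Normc.normcV; apply: ub_le_sup; last by exists l^-1.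
exists (2 * bnorm a) => _ [m hm <-]; exact: spectrum_bounded.
Qed.

(** * The spectral radius formula along powers of two *)

(** Partial fractions of [1 / (1 - b^2)].  This replaces the average over all
    N-th roots of unity in the elementary proofs of Gelfand's formula. *)
Lemma invr_1B_sqr (R : realType) (B : unitAlgType R[i]) (b : B) :
    1 - b \is a GRing.unit -> 1 + b \is a GRing.unit ->
  1 - b * b \is a GRing.unit /\
  (1 - b * b)^-1 = 2^-1 *: ((1 - b)^-1 + (1 + b)^-1).
Proof.
move=> um up.
have e1 : 1 - b * b = (1 - b) * (1 + b).
  by rewrite mulrBl mul1r mulrDr mulr1 opprD addrA addrK.
have e2 : 1 - b * b = (1 + b) * (1 - b).
  by rewrite mulrDl mul1r mulrBr mulr1 addrA subrK.
have u : 1 - b * b \is a GRing.unit by rewrite e1 unitrMr.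
split=> //; apply: (mulrI u); rewrite divrr// -scalerAr mulrDr {1}e2 mulrK//.
rewrite e1 mulrK// addrCA addrK -mulr2n -(scaler_nat 2 (1 : B)).
by rewrite scalerA mulVf ?scale1r// pnatr_eq0.
Qed.

(** The resolvent identity, in norm. *)
Lemma resolvent_diff (R : realType) (B : banachAlg R) (a : B) (l m : R[i]) :
    1 - l *: a \is a GRing.unit -> 1 - m *: a \is a GRing.unit ->
  bnorm ((1 - l *: a)^-1 - (1 - m *: a)^-1)
    <= normc (l - m)
       * (bnorm (1 - l *: a)^-1 * bnorm a * bnorm (1 - m *: a)^-1).
Proof.
move=> ul um.
have -> : (1 - l *: a)^-1 - (1 - m *: a)^-1
    = (l - m) *: ((1 - l *: a)^-1 * a * (1 - m *: a)^-1).
  rewrite scalerAl scalerAr scalerBl.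
  have -> : l *: a - m *: a = (1 - m *: a) - (1 - l *: a).
    by rewrite opprB [RHS]addrC addrA subrK.
  by rewrite mulrBr mulVr// mulrBl mul1r mulrK.
rewrite bnorm_scale; apply: ler_wpM2l; first exact: normc_ge0.
apply: le_trans (ler_bnormM _ _) _; apply: ler_wpM2r; first exact: bnorm_ge0.
exact: ler_bnormM.
Qed.

(** A local bound at each point of the disc follows from the resolvent identity;
    compactness of a square containing the disc makes it uniform.  The bounds
    are indexed by natural numbers so that the near-covering form of compactness
    applies along the filter of large [n]. *)
Lemma resolvent_bounded (R : realType) (B : banachAlg R) (a : B) (s : R) :
    (forall l, normc l <= s -> 1 - l *: a \is a GRing.unit) ->
  exists M, forall l, normc l <= s -> bnorm (1 - l *: a)^-1 <= M.
Proof.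
move=> us.
pose toC (p : R * R) : R[i] := (p.1 +i* p.2)%C.
pose K : set (R * R) := `[- s, s]%classic `*` `[- s, s]%classic.
have cK : compact K by apply: compact_setX; exact: segment_compact.
have nearC (p : R * R) (d : R) : 0 < d ->
    \forall q \near p, normc (toC q - toC p) <= d.
  move=> d0; apply/nbhs_ballP; exists (d / 2); first by rewrite /= divr_gt0.
  move=> q [b1 b2]; rewrite [d in X in _ <= X]splitr; apply: normc_sub_coord => /=.
    by move: b1; rewrite /ball /= distrC => /ltW.
  by move: b2; rewrite /ball /= distrC => /ltW.
have cov (p : R * R) : K p -> \forall q \near p & n \near \oo,
    normc (toC q) <= s -> bnorm (1 - toC q *: a)^-1 <= n%:R :> R.
  move=> _; have [ps|sp] := leP (normc (toC p)) s; last first.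
    (* Outside the disc the bound is void on a whole neighbourhood of p. *)
    have d0 : 0 < (normc (toC p) - s) / 2 by rewrite divr_gt0// subr_gt0.
    exists ([set q | normc (toC q - toC p) <= (normc (toC p) - s) / 2], setT).
      by split; [exact: nearC | exact: filterT].
    move=> [q n] [hq _] qs; rewrite /= in hq; exfalso.
    have := normcD_le (toC q) (- (toC q - toC p)).
    rewrite opprB addrC subrK.
    have -> : normc (toC p - toC q) = normc (toC q - toC p).
      by rewrite -opprB; exact: (@normcN R (toC q - toC p)).
    lra.
  pose A := bnorm a * bnorm (1 - toC p *: a)^-1.
  have A0 : 0 <= A by rewrite mulr_ge0// bnorm_ge0.
  have d0 : 0 < (2 * (A + 1))^-1 by rewrite invr_gt0 mulr_gt0// ltr_wpDl.
  exists ([set q | normc (toC q - toC p) <= (2 * (A + 1))^-1],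
          [set n | 2 * bnorm (1 - toC p *: a)^-1 <= n%:R]).
    by split; [exact: nearC | exact: nbhs_infty_ger].
  move=> [q n] [hq hn] qs; rewrite /= in hq hn; apply: le_trans hn.
  have := resolvent_diff (us _ qs) (us _ ps).
  rewrite -mulrA -/A; set N := bnorm (1 - toC q *: a)^-1; set N0 := bnorm _^-1.
  have N_ge0 : 0 <= N by exact: bnorm_ge0.
  have : N <= bnorm ((1 - toC q *: a)^-1 - (1 - toC p *: a)^-1) + N0.
    by rewrite -[X in bnorm X <= _](subrK (1 - toC p *: a)^-1) ler_bnormD.
  have : normc (toC q - toC p) * (N * A) <= N / 2.
    have h : normc (toC q - toC p) * A <= 2^-1.
      apply: (@le_trans _ _ ((2 * (A + 1))^-1 * A)); first exact: ler_wpM2r.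
      rewrite invfM -mulrA ler_piMr// mulrC ler_pdivrMr ?ltr_wpDl// mul1r.
      by rewrite lerDl.
    by rewrite mulrCA; apply: ler_wpM2l.
  lra.
have [n _ hn] := (compact_near_coveringP K).1 cK _ _ _ _ cov.
exists n%:R => l ls; have [c1 c2] := coord_le_normc l.
have := hn n (leqnn n) (complex.Re l, complex.Im l).
rewrite /toC /=; have -> : (complex.Re l +i* complex.Im l)%C = l by case: (l).
apply=> //; split; rewrite /= in_itv /= -ler_norml.
  exact: le_trans c1 ls.
exact: le_trans c2 ls.
Qed.

(** The point is that [L] is independent of [k].  If [z ^+ (2 ^ k) = -1], then by
    [invr_1B_sqr] the function for [k + 1] at [l] is the mean of the function
    for [k] at [l] and at [z * l].  As [z] has modulus 1, this mean keeps both
    the disc and the Lipschitz constant. *)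
Lemma iter_resolvent_lipschitz (R : realType) (B : banachAlg R) (a : B) (s : R) :
    (forall l, normc l <= s -> 1 - l *: a \is a GRing.unit) ->
  exists2 L : R, 0 <= L & forall k l m, normc l <= s -> normc m <= s ->
    1 - (l *: a) ^+ (2 ^ k) \is a GRing.unit /\
    bnorm ((1 - (l *: a) ^+ (2 ^ k))^-1 - (1 - (m *: a) ^+ (2 ^ k))^-1)
      <= L * normc (l - m).
Proof.
move=> us; have [M hM] := resolvent_bounded us.
exists (`|M| * bnorm a * `|M|); first by rewrite !mulr_ge0// bnorm_ge0.
set L := _ * _ * _.
have hM' l : normc l <= s -> bnorm (1 - l *: a)^-1 <= `|M|.
  by move=> /hM /le_trans; apply; exact: ler_norm.
elim=> [|k IH] l m ls ms.
  rewrite !expn0 !expr1; split; first exact: us.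
  apply: le_trans (resolvent_diff (us _ ls) (us _ ms)) _.
  rewrite mulrC; apply: ler_wpM2r; first exact: normc_ge0.
  by apply: ler_pM; rewrite ?mulr_ge0 ?bnorm_ge0 ?ler_wpM2r ?bnorm_ge0 ?hM'.
have [z zN z1] := @root_minus1 R (2 ^ k) (expn_gt0 2 k).
have zs n : normc n <= s -> normc (z * n) <= s.
  by rewrite ComplexField.Normc.normcM z1 mul1r.
have step n : normc n <= s ->
    1 - (n *: a) ^+ (2 ^ k.+1) \is a GRing.unit /\
    (1 - (n *: a) ^+ (2 ^ k.+1))^-1 = 2^-1 *:
      ((1 - (n *: a) ^+ (2 ^ k))^-1 + (1 - ((z * n) *: a) ^+ (2 ^ k))^-1).
  move=> ns; have [u1 _] := IH n n ns ns.
  have [u2 _] := IH _ _ (zs _ ns) (zs _ ns).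
  have e : (z * n *: a) ^+ (2 ^ k) = - (n *: a) ^+ (2 ^ k).
    by rewrite -scalerA exprZn zN scaleN1r.
  move: u2; rewrite e opprK => u2.
  by rewrite expnS mul2n -addnn exprD; exact: invr_1B_sqr.
have [ul ->] := step l ls; have [um ->] := step m ms; split=> //.
have [_ h1] := IH l m ls ms; have [_ h2] := IH _ _ (zs _ ls) (zs _ ms).
rewrite -scalerBr bnorm_scale opprD addrACA.
have -> : normc (2^-1 : R[i]) = 2^-1.
  rewrite ComplexField.Normc.normcV; congr _^-1.
  have -> : (2 : R[i]) = (2%:C)%C by rewrite rmorph_nat.
  by rewrite normc_real ger0_norm.
rewrite mulrC ler_pdivrMr//; apply: le_trans (ler_bnormD _ _) _.
move: h2; rewrite -mulrBr ComplexField.Normc.normcM z1 mul1r; lra.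
Qed.

(** With [c = (1 - b)^-1 - 1] one has [b = c - b * c], and also [c = b + b * c]. *)
Lemma bnorm_le_of_resolvent (R : realType) (B : banachAlg R) (b : B) :
    1 - b \is a GRing.unit -> bnorm ((1 - b)^-1 - 1) <= 4^-1 -> bnorm b <= 2^-1.
Proof.
move=> u; set c := _ - 1 => hc.
have e : b = c - b * c.
  by rewrite -[X in X - _]mul1r -mulrBl /c mulrBr mulr1 divrr// subKr.
have := ler_bnormB c (b * c); rewrite -e; have := ler_bnormM b c.
have : bnorm b * bnorm c <= bnorm b * 4^-1
  by apply: ler_wpM2l => //; exact: bnorm_ge0.
lra.
Qed.

Lemma resolvent_le_of_bnorm (R : realType) (B : banachAlg R) (b : B) :
    1 - b \is a GRing.unit -> bnorm b <= 16^-1 -> bnorm ((1 - b)^-1 - 1) <= 8^-1.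
Proof.
move=> u hb; set c := _ - 1.
have e : c = b + b * c.
  rewrite /c mulrBr mulr1 [RHS]addrC subrK -[X in _ - X](divrr u).
  by rewrite -[X in X - _]mul1r -mulrBl subKr.
have := ler_bnormD b (b * c); rewrite -e; have := ler_bnormM b c.
have : bnorm b * bnorm c <= 16^-1 * bnorm c
  by apply: ler_wpM2r => //; exact: bnorm_ge0.
lra.
Qed.

Lemma bnorm_iter_sqr (R : realType) (B : banachAlg R) (b : B) (k j : nat) :
    bnorm (b ^+ (2 ^ k)) <= 2^-1 ->
  bnorm (b ^+ (2 ^ (k + j))) <= 2^-1 ^+ j.+1.
Proof.
move=> h; elim: j => [|j IH]; first by rewrite addn0 expr1.
rewrite addnS expnS mul2n -addnn exprD; apply: le_trans (ler_bnormM _ _) _.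
apply: (@le_trans _ _ (2^-1 ^+ j.+1 * 2^-1 ^+ j.+1)).
  by apply: ler_pM; rewrite ?bnorm_ge0.
rewrite -exprD; apply: ler_wiXn2l; rewrite ?invr_ge0 ?invf_le1 ?ler1n//.
by rewrite addnS ltnS leq_addr.
Qed.

(** The half of Gelfand's formula that is needed here.  The functions
    [l |-> (1 - (l a)^(2^k))^-1] are uniformly Lipschitz on the disc, and near
    [l = 0] they tend to 1.  Proximity to 1 then propagates along the radius from
    0 to [s] in finitely many short steps: an error 1/8 at one point gives an
    error at most 1/4 at the next, which forces a power of norm at most 1/2
    there, and squaring that power restores the error 1/8. *)
Lemma bnorm_iter_sqr_cvg0 (R : realType) (B : banachAlg R) (a : B) (s : R) :
    0 <= s -> s * spectral_radius a < 1 ->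
  (fun k => bnorm (((s%:C)%C *: a) ^+ (2 ^ k))) @ \oo --> (0 : R).
Proof.
move=> s0 hs.
have [L L0 hL] := iter_resolvent_lipschitz (fun l => @unitr_1BZ R B a s l hs).
(* The step s / m is so short that the Lipschitz bound over it is at most 1/8. *)
pose m := (Num.bound (8 * L * s)).+1.
have m0 : 0 < m%:R :> R by rewrite ltr0n.
have hm : 8 * L * s <= m%:R.
  have h : 0 <= 8 * L * s by rewrite !mulr_ge0.
  by apply: le_trans (ltW (archi_boundP h)) _; rewrite ler_nat.
pose mu (j : nat) : R[i] := ((s * j%:R / m%:R)%:C)%C.
have mus j : (j <= m)%N -> normc (mu j) <= s.
  move=> jm; rewrite normc_real ger0_norm ?mulr_ge0 ?invr_ge0 ?ler0n//.
  by rewrite ler_pdivrMr// ler_wpM2l// ler_nat.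
have chain j : (j <= m)%N -> exists k, bnorm ((mu j *: a) ^+ (2 ^ k)) <= 2^-1.
  elim: j => [_|j IH jm].
    by exists 0%N; rewrite /mu mulr0 mul0r scale0r expr0n bnorm0 invr_ge0.
  have [k hk] := IH (ltnW jm).
  (* From 1/2 at exponent 2^k, squaring three times gives 1/16. *)
  exists (k + 3)%N.
  have [u1 hd] := hL (k + 3)%N _ _ (mus _ jm) (mus _ (ltnW jm)).
  have [u0 _] := hL (k + 3)%N _ _ (mus _ (ltnW jm)) (mus _ jm).
  apply: bnorm_le_of_resolvent => //.
  have h0 : bnorm ((1 - (mu j *: a) ^+ (2 ^ (k + 3)))^-1 - 1) <= 8^-1.
    apply: resolvent_le_of_bnorm => //.
    by have := bnorm_iter_sqr 3 hk; rewrite !exprS expr0; lra.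
  have h1 : L * normc (mu j.+1 - mu j) <= 8^-1.
    rewrite /mu -rmorphB normc_real -mulrBl -mulrBr -natrB// subSnn mulr1.
    rewrite ger0_norm ?mulr_ge0 ?invr_ge0 ?ler0n// mulrA ler_pdivrMr//.
    by rewrite -(@ler_pM2l _ 8)// mulrA mulrA mulfV// mul1r.
  set x := (1 - (mu j.+1 *: a) ^+ _)^-1 in hd *.
  set y := (1 - (mu j *: a) ^+ _)^-1 in hd h0 *.
  have -> : x - 1 = (x - y) + (y - 1) by rewrite addrA subrK.
  have := ler_bnormD (x - y) (y - 1); lra.
have [k] := chain m (leqnn m).
rewrite /mu -mulrA divff ?lt0r_neq0// mulr1 => hk.
rewrite -(cvg_shiftn k) /=.
have h : (fun n : nat => 1 * 2^-1 ^+ n) @ \oo --> (0 : R) by exact: cvg_half_expr.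
apply: squeeze_cvgr (cvg_cst 0) h; apply: nearW => j.
rewrite bnorm_ge0 mul1r addnC; apply: le_trans (bnorm_iter_sqr j hk) _.
by rewrite exprS ler_piMl ?exprn_ge0 ?invr_ge0// invf_le1 ?ler1n.
Qed.

(** * Convergence *)

Lemma exprJ (B : unitRingType) (S V : B) n : S \is a GRing.unit ->
  (S * V * S^-1) ^+ n = S * V ^+ n * S^-1.
Proof.
move=> uS; elim: n => [|n IH]; first by rewrite !expr0 mulr1 divrr.
by rewrite !exprSr IH !mulrA mulrVK.
Qed.

(** By similarity only powers of [V] and [G] matter.  The weight
    [s = (1 + v) / (1 + g)] satisfies [s * g < 1] and [v / s < 1] exactly because
    [g * v < 1], also when one of the radii vanishes; rescaling [G] by [s] and
    [V] by [s^-1] leaves the product unchanged and makes both factors tend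
    to 0. *)
Lemma bnorm_conj_sandwich_cvg0 (R : realType) (B : banachAlg R) (G V S H : B) :
    S \is a GRing.unit -> spectral_radius G * spectral_radius V < 1 ->
  (fun k => bnorm ((S * V * S^-1) ^+ (2 ^ k) * H * G ^+ (2 ^ k)))
    @ \oo --> (0 : R).
Proof.
move=> uS hGV; set g := spectral_radius G in hGV.
set v := spectral_radius V in hGV.
have g0 : 0 <= g by exact: spectral_radius_ge0.
have v0 : 0 <= v by exact: spectral_radius_ge0.
pose s := (1 + v) / (1 + g).
have g1 : 0 < 1 + g by rewrite ltr_wpDr.
have v1 : 0 < 1 + v by rewrite ltr_wpDr.
have s0 : 0 < s by rewrite divr_gt0.
have hsG : s * g < 1.
  by rewrite /s mulrAC ltr_pdivrMr// mul1r mulrDl mul1r mulrC; lra.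
have hsV : s^-1 * v < 1.
  by rewrite /s invf_div mulrAC ltr_pdivrMr// mul1r mulrDl mul1r; lra.
have cG := bnorm_iter_sqr_cvg0 (ltW s0) hsG.
have cV := bnorm_iter_sqr_cvg0 (ltW (etrans (invr_gt0 s) s0)) hsV.
pose C := bnorm S * bnorm (S^-1 * H).
have lim0 : (fun k => C * (bnorm (((s^-1%:C)%C *: V) ^+ (2 ^ k)) *
    bnorm (((s%:C)%C *: G) ^+ (2 ^ k)))) @ \oo --> (0 : R).
  by have := cvgM (cvg_cst C) (cvgM cV cG); rewrite !mulr0; exact.
apply: squeeze_cvgr (cvg_cst 0) lim0; apply: nearW => k; rewrite bnorm_ge0 /=.
rewrite (exprJ _ _ uS).
have -> : S * V ^+ (2 ^ k) / S * H * G ^+ (2 ^ k) =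
    S * ((s^-1%:C)%C *: V) ^+ (2 ^ k) * (S^-1 * H) * ((s%:C)%C *: G) ^+ (2 ^ k).
  rewrite !exprZn -!(scalerAl, scalerAr) scalerA -exprMn -rmorphM.
  by rewrite mulfV ?lt0r_neq0// expr1n scale1r !mulrA.
set x := _ ^+ _; set y := (_ *: G) ^+ _.
do !apply: le_trans (ler_bnormM _ _) _.
rewrite /C [leRHS]mulrA; apply: ler_wpM2r; first exact: bnorm_ge0.
apply: le_trans (ler_bnormM _ _) _.
rewrite mulrAC; apply: ler_wpM2r; first exact: bnorm_ge0.
exact: ler_bnormM.
Qed.

(** The occurrence of [D k] on the right is absorbed on the left as soon as
    [bnorm y * bnorm (X k) <= 1 / 2]. *)
Lemma cvg0_of_affine_bound (R : realType) (B : banachAlg R) (D X : nat -> B)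
    (c y : B) :
    (forall k, D k = (c + D k * y) * X k) ->
    (fun k => bnorm (X k)) @ \oo --> (0 : R) ->
  (fun k => bnorm (D k)) @ \oo --> (0 : R).
Proof.
move=> hD hX.
have lim0 : (fun k => 2 * bnorm c * bnorm (X k)) @ \oo --> (0 : R).
  by have := cvgM (cvg_cst (2 * bnorm c)) hX; rewrite mulr0; exact.
apply: squeeze_cvgr (cvg_cst 0) lim0.
have d0 : 0 < (2 * (bnorm y + 1))^-1.
  by rewrite invr_gt0 mulr_gt0// ltr_wpDl// bnorm_ge0.
have /cvgrPdist_lt/(_ _ d0) := hX; apply: filterS => k.
rewrite sub0r normrN ger0_norm ?bnorm_ge0// => /ltW hk /=.
have h : bnorm y * bnorm (X k) <= 2^-1.
  apply: (@le_trans _ _ (bnorm y * (2 * (bnorm y + 1))^-1)).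
    by apply: ler_wpM2l => //; exact: bnorm_ge0.
  rewrite invfM mulrCA ler_piMr// ler_pdivrMr ?mul1r ?lerDl//.
  by rewrite ltr_wpDl// bnorm_ge0.
have := ler_bnormM (c + D k * y) (X k); rewrite -hD.
have : bnorm (c + D k * y) * bnorm (X k)
    <= (bnorm c + bnorm (D k) * bnorm y) * bnorm (X k).
  apply: ler_wpM2r; first exact: bnorm_ge0.
  apply: le_trans (ler_bnormD _ _) _; rewrite lerD2l; exact: ler_bnormM.
rewrite mulrDl -[_ * bnorm y * _]mulrA.
have : bnorm (D k) * (bnorm y * bnorm (X k)) <= bnorm (D k) * 2^-1.
  by apply: ler_wpM2l => //; exact: bnorm_ge0.
rewrite -[2 * _ * _]mulrA.
lra.
Qed.

Theorem mainTheorem7 (R : realType) (B : banachAlg R)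
    (Am1 A0 A1 G V Gt : B)
    (hA0 : A0 \is a GRing.unit)
    (hG : A1 * G ^+ 2 + A0 * G + Am1 = 0)
    (hV : Am1 * V ^+ 2 + A0 * V + A1 = 0)
    (hrG : spectral_radius G <= 1)
    (hrV : spectral_radius V <= 1)
    (hrGV : spectral_radius G * spectral_radius V < 1)
    (hW : A0 + A1 * Gt \is a GRing.unit)
    (hGtV : 1 - Gt * V \is a GRing.unit) :
  let H := G - Gt in
  let Y := V * (1 - Gt * V)^-1 in
  let Z := (1 - Gt * V) * V * (1 - Gt * V)^-1 in
  let P0 := - ((A0 + A1 * Gt)^-1 * (A1 * Gt ^+ 2 + A0 * Gt + Am1)) in
  let E0 := Gt + P0 in
  let F0 := - ((A0 + A1 * Gt)^-1 * A1) in
  let Q0 := F0 in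
  let E k := sdaE (sda E0 F0 P0 Q0 k) in
  let F k := sdaF (sda E0 F0 P0 Q0 k) in
  let P k := sdaP (sda E0 F0 P0 Q0 k) in
  let Q k := sdaQ (sda E0 F0 P0 Q0 k) in
  sda_no_breakdown E0 F0 P0 Q0 ->
  (fun k => bnorm (P k - H)) @ \oo --> (0 : R) /\
  forall k : nat,
    [/\ E k = (1 - Q k * H) * G ^+ (2 ^ k),
        H - P k = F k * H * G ^+ (2 ^ k),
        F k = (1 - P k * Y) * Z ^+ (2 ^ k) &
        Y - Q k = E k * Y * Z ^+ (2 ^ k)].
Proof.
move=> H Y Z P0 E0 F0 Q0 E F P Q nb.
have [hE hP] := sda0_invariantEP hG hW.
have [hF hQ] := sda0_invariantFQ hV hW hGtV.
have inv k : [/\ E k = (1 - Q k * H) * G ^+ (2 ^ k),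
    H - P k = F k * H * G ^+ (2 ^ k),
    F k = (1 - P k * Y) * Z ^+ (2 ^ k) &
    Y - Q k = E k * Y * Z ^+ (2 ^ k)].
  have := sda_closed_form nb hE hP hF hQ k.
  by rewrite /E /F /P /Q; case: (sda _ _ _ _ k).
split=> //.
(* Substituting F k into the identity for H - P k makes P k - H appear on
   both sides, with factor Z^(2^k) H G^(2^k). *)
apply: (@cvg0_of_affine_bound R B (fun k => P k - H)
  (fun k => Z ^+ (2 ^ k) * H * G ^+ (2 ^ k)) (H * Y - 1) Y); last first.
  exact: bnorm_conj_sandwich_cvg0.
move=> k; have [_ h1 h2 _] := inv k.
have -> : H * Y - 1 + (P k - H) * Y = - (1 - P k * Y).
  by rewrite (mulrBl Y (P k) H) addrC addrA subrK opprB.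
by rewrite -opprB h1 h2 mulNr !mulrA.
Qed.
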